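(* Let $p$ be a prime, $q=p^e$, $m,k\ge1$, and let $f\in\mathbb{F}_{q^m}[x_1,\dots,x_k]$ be a homogeneous polynomial of degree $d\ge1$. Put $g=\gcd\big(d,\frac{q^m-1}{q-1}\big)$. Then \[\nu_p\big(N(f=y^q-y)\big)\ge\Big\lceil\frac{em}{g}\Big\lceil\frac{g\,k}{d}\Big\rceil\Big\rceil.\] In particular, when $g=1$, every homogeneous polynomial $f$ of degree $d$ satisfies $\nu_p(N(f=y^q-y))\ge em\lceil k/d\rceil$, and there exists a homogeneous polynomial $f$ of degree $d$ attaining equality.
   Context: $N(f=y^q-y)$ denotes the number of $(x_1,\dots,x_k,y)\in\mathbb{F}_{q^m}^{k+1}$ with $f(x_1,\dots,x_k)=y^q-y$; $\nu_p$ is the $p$-adic valuation. *)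

(* Defs.v *)
From HB Require Import structures.
From mathcomp Require Import all_boot all_order all_algebra all_field.
From mathcomp Require Import mpoly.
Set Implicit Arguments. Unset Strict Implicit. Unset Printing Implicit Defensive.
Import GRing.Theory.
Local Open Scope ring_scope.

Definition ceil_div (a b : nat) : nat := ((a + b.-1) %/ b)%N.

Definition Nsol (K : finFieldType) (k q : nat) (f : {mpoly K[k]}) : nat :=
  #|[set xy : {ffun 'I_k -> K} * K | f.@[xy.1] == xy.2 ^+ q - xy.2]|.

(* Main.v *)
Require Import Defs.
From HB Require Import structures.
From mathcomp Require Import all_boot all_order all_algebra all_field cyclic.
From mathcomp Require Import mpoly.
From mathcomp Require Import zify ring.
Set Implicit Arguments. Unset Strict Implicit. Unset Printing Implicit Defensive.
Import Order.TTheory GRing.Theory Num.Theory.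

(* Write E = e m, Q = p^E, and let psi be the additive character of F_Q attached to
   a p-th root of unity zeta. The number of y with y^q - y = c is the sum of
   psi (t c) over t in F_q, so N is the sum of psi (t f(x)) over t in F_q and x.
   Work in Z[z], z a primitive p(Q-1)-th root of unity, with the valuation at a
   prime above p for which 1 - zeta has valuation 1 and p has valuation p - 1.
   Expanding psi in powers of the Teichmuller character T, the coefficient of T^j
   is a Gauss sum, whose valuation is at least the base-p digit sum of j (the easy
   half of Stickelberger's theorem). After expanding psi (t f(x)) along the
   monomials of f, the orthogonality relations keep only families of exponents j_i
   satisfying divisibility conditions modulo Q - 1. These conditions are stable
   under cyclic rotation of the E base-p digits of the j_i, and the digit sums
   are recovered by adding up all the rotations, which gives the lower bound.
   For sharpness, cut the k variables into B = ceil(k/d) blocks and let M_b be a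
   monomial of degree d in exactly the variables of block b. The sum of N over all
   polynomials a_1 M_1 + ... + a_B M_B is Q^B times a number prime to p, so one of
   these polynomials has valuation at most E B. *)

(** * Rotation of base-p digits *)

Section DigitRotation.
Variables (p E : nat).
Hypothesis p_gt1 : 1 < p.

(** For [j < p ^ E] this rotates the [E] digits cyclically by [h] places. A larger [j] keeps its
    excess in the quotient, so that multiplication by [p] needs no reduction. *)
Definition digit_rot h j := p ^ h * (j %% p ^ (E - h)) + j %/ p ^ (E - h).

(** Modulo [p ^ E - 1] the factor [p ^ E] is 1, so digits pushed past the top reenter at the
    bottom. *)
Lemma digit_rot_mod h j : h <= E -> digit_rot h j = p ^ h * j %[mod (p ^ E).-1].
Proof.
move=> hE; rewrite /digit_rot {3}(divn_eq j (p ^ (E - h))) mulnDr.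
set A := j %/ _; set B := j %% _.
rewrite mulnCA -expnD subnKC // addnC.
have -> : A * p ^ E = A * (p ^ E).-1 + A.
  by rewrite -mulnSr prednK // expn_gt0 (ltnW p_gt1).
by rewrite -addnA modnMDl.
Qed.

Lemma digit_rot0 h : digit_rot h 0 = 0.
Proof. by rewrite /digit_rot mod0n div0n muln0. Qed.

Lemma digit_rot_gt0 h j : 0 < j -> 0 < digit_rot h j.
Proof.
move=> j0; rewrite /digit_rot addn_gt0 muln_gt0 expn_gt0 (ltnW p_gt1) /=.
case: (posnP (j %% _)) => //= /eqP jd.
by rewrite divn_gt0 ?expn_gt0 ?(ltnW p_gt1) // dvdn_leq.
Qed.

Lemma digit_rot_mulp h j : h < E -> digit_rot h (p * j) = digit_rot h.+1 j.
Proof.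
move=> hE; rewrite /digit_rot.
have -> : E - h = (E - h.+1).+1 by lia.
rewrite expnS -muln_modr divnMl ?(ltnW p_gt1) // expnS; lia.
Qed.

(** No carry occurs: only the lowest digit grows by one, and the rotation sends it to place [h]. *)
Lemma digit_rotS h j : h < E -> ~~ (p %| j.+1) ->
  digit_rot h j.+1 = digit_rot h j + p ^ h.
Proof.
move=> hE pj; rewrite /digit_rot; set P := p ^ (E - h).
have P0 : 0 < P by rewrite expn_gt0 (ltnW p_gt1).
have Pj : ~~ (P %| j.+1).
  apply: contra pj; apply: dvdn_trans.
  by rewrite /P -(@prednK (E - h)) ?subn_gt0 // expnS dvdn_mulr.
rewrite modnS divnS // (negPf Pj) add0n; nia.
Qed.

(** Over all rotations each digit visits each place once, so for [j < p ^ E] this is the digit sum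
    times [repunit]. *)
Definition rot_sum j := \sum_(h < E) digit_rot h j.
Definition repunit := \sum_(h < E) p ^ h.

Lemma predn_expE : (p ^ E).-1 = p.-1 * repunit.
Proof. by rewrite predn_exp. Qed.

Lemma rot_sum0 : rot_sum 0 = 0.
Proof. by rewrite /rot_sum big1 // => i _; rewrite digit_rot0. Qed.

Lemma rot_sum_mulp j : j < p ^ E -> rot_sum (p * j) = rot_sum j.
Proof.
move=> jE; rewrite /rot_sum.
under eq_bigr => i _ do rewrite digit_rot_mulp //.
have rE : digit_rot E j = digit_rot 0 j.
  rewrite /digit_rot subnn subn0 expn0 modn1 divn1 muln0 mul1n.
  by rewrite modn_small // divn_small // addn0.
apply: (@addnI (digit_rot 0 j)); rewrite -(big_ord_recl E (fun i : 'I_E.+1 => digit_rot i j)).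
by rewrite big_ord_recr /= rE addnC.
Qed.

Lemma rot_sumS j : ~~ (p %| j.+1) -> rot_sum j.+1 = rot_sum j + repunit.
Proof.
move=> pj; rewrite /rot_sum /repunit -big_split /=.
by apply: eq_bigr => i _; rewrite digit_rotS.
Qed.

Lemma rot_sum_max : rot_sum (p ^ E).-1 = E * (p ^ E).-1.
Proof.
rewrite /rot_sum (eq_bigr (fun=> (p ^ E).-1)) ?sum_nat_const ?card_ord // => h _.
have := ltn_ord h => hE; rewrite /digit_rot.
set a := p ^ (E - h); set b := p ^ h.
have a0 : 0 < a by rewrite expn_gt0 (ltnW p_gt1).
have b0 : 0 < b by rewrite expn_gt0 (ltnW p_gt1).
have -> : p ^ E = b * a by rewrite -expnD subnKC // ltnW.
have -> : (b * a).-1 = b.-1 * a + a.-1 by nia.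
rewrite modnMDl modn_small ?prednK // divnMDl // divn_small ?prednK //; nia.
Qed.

Hypothesis E_gt0 : 0 < E.

Lemma repunit_gt0 : 0 < repunit.
Proof. by rewrite /repunit (bigD1 (Ordinal E_gt0)) //= expn0. Qed.

(* The sum of the base-p digits of j, for j < p ^ E. *)
Definition digit_sum j := rot_sum j %/ repunit.

Lemma digit_sum0 : digit_sum 0 = 0.
Proof. by rewrite /digit_sum rot_sum0 div0n. Qed.

Lemma digit_sum_mulp j : j < p ^ E -> digit_sum (p * j) = digit_sum j.
Proof. by move=> jE; rewrite /digit_sum rot_sum_mulp. Qed.

Lemma digit_sumS j : ~~ (p %| j.+1) -> digit_sum j.+1 = (digit_sum j).+1.
Proof.
by move=> pj; rewrite /digit_sum rot_sumS // divnDr // divnn repunit_gt0 addn1.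
Qed.

Lemma digit_sum_max : digit_sum (p ^ E).-1 = E * p.-1.
Proof.
by rewrite /digit_sum rot_sum_max predn_expE mulnA mulnK // repunit_gt0.
Qed.

Lemma rot_sumE j : j < p ^ E -> rot_sum j = digit_sum j * repunit.
Proof.
move=> jE; rewrite /digit_sum divnK //.
elim/ltn_ind: j jE => -[_ _|j IH jE]; first by rewrite rot_sum0.
case: (boolP (p %| j.+1)) => [/dvdnP [i ij]|pj].
  have ltij : i < j.+1 by rewrite ij ltn_Pmulr //; lia.
  rewrite ij mulnC rot_sum_mulp ?IH //; exact: ltn_trans ltij jE.
by rewrite rot_sumS // dvdn_addl // IH // ltnW.
Qed.


(** Rotation preserves the divisibilities, and a column with nonzero sum keeps a nonzero rotated
    sum, hence one at least [n]. This bounds the rotated total for each [h]; adding over [h] turns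
    totals into digit sums. The term in [z] compensates for the zero columns, and [C] plays the
    ceiling of [g * k / d]. *)
Lemma digit_weight_bound (g d C k M : nat) (j : 'I_M -> nat)
    (D : 'I_M -> 'I_k -> nat) (n := (p ^ E).-1)
    (z := #|[pred l | \sum_i j i * D i l == 0]|) :
    0 < d ->
    (forall A, g * k <= d * A -> C <= A) ->
    (forall i, j i <= n) ->
    (forall i, \sum_l D i l = d) ->
    (forall l, n %| \sum_i j i * D i l) ->
    n %| g * \sum_i j i ->
  E * p.-1 * C <= g * (\sum_i digit_sum (j i) + E * p.-1 * z).
Proof.
move=> d0 leC jn sumD dvd_col dvd_tot.
have pE0 : 0 < p ^ E by rewrite expn_gt0 (ltnW p_gt1).
have n0 : 0 < n by rewrite /n; have := ltn_expl E p_gt1; lia.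
have r0 := repunit_gt0.
have rot_dvd h (c : 'I_M -> nat) : h <= E ->
    n %| \sum_i j i * c i -> n %| \sum_i digit_rot h (j i) * c i.
  move=> hE nj; rewrite /dvdn -modn_summ.
  under eq_bigr => i _ do rewrite -modnMml digit_rot_mod // modnMml -mulnA.
  by rewrite modn_summ -big_distrr /= -/(dvdn n _) dvdn_mull.
have bound h : h < E -> n * C <= g * \sum_i digit_rot h (j i) + n * (g * z).
  move=> /ltnW hE; set R := \sum_i _.
  have nR : n %| g * R.
    rewrite mulnC big_distrl /=; apply: rot_dvd => //.
    by rewrite -big_distrl /= mulnC.
  have col l : n * (\sum_i j i * D i l != 0) <= \sum_i digit_rot h (j i) * D i l.
    case: eqP => [_|/eqP]; rewrite ?muln0 // muln1 -lt0n => nz.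
    apply: dvdn_leq; last exact: rot_dvd.
    have [i /andP [ji Di]] : exists i, (0 < j i) && (0 < D i l).
      apply/existsP; apply: contraLR nz; rewrite negb_exists -leqNgt leqn0 => /forallP H.
      rewrite sum_nat_eq0; apply/forallP => i; have := H i.
      by rewrite -muln_gt0 -eqn0Ngt.
    by rewrite (bigD1 i) //= addn_gt0 muln_gt0 digit_rot_gt0 // Di.
  have sum_col : \sum_l \sum_i digit_rot h (j i) * D i l = d * R.
    rewrite exchange_big /= mulnC big_distrl /=; apply: eq_bigr => i _.
    by rewrite -big_distrr /= sumD.
  have count : \sum_l (\sum_i j i * D i l != 0) + z = k.
    have -> : z = \sum_l (\sum_i j i * D i l == 0).
      by rewrite /z -sum1_card big_mkcond; apply: eq_bigr => l _; rewrite inE; case: eqP.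
    rewrite -big_split /= -[RHS]card_ord -sum1_card.
    by apply: eq_bigr => l _; case: eqP.
  have le : \sum_l n * (\sum_i j i * D i l != 0) <= d * R.
    by rewrite -sum_col; apply: leq_sum => l _; apply: col.
  rewrite -big_distrr /= in le.
  have [A gR] := dvdnP nR; rewrite gR.
  set s := \sum_(l < k) _ in le count.
  (* Multiplying [n * s <= d * R] by [g] gives [g * s <= d * A]; the zero columns add
     [g * z <= d * (g * z)]. *)
  have : C <= A + g * z; last by nia.
  apply: leC; rewrite -count.
  have : g * s <= d * A; last by nia.
  by rewrite -(leq_pmul2l n0); nia.
have : \sum_(h < E) n * C <= \sum_(h < E) (g * \sum_i digit_rot h (j i) + n * (g * z)).
  by apply: leq_sum => h _; apply: bound.
rewrite sum_nat_const card_ord big_split /= sum_nat_const card_ord -big_distrr /=.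
rewrite exchange_big /=.
have -> : \sum_i \sum_(h < E) digit_rot h (j i) = (\sum_i digit_sum (j i)) * repunit.
  rewrite big_distrl /=; apply: eq_bigr => i _; rewrite -rot_sumE //.
  by have := jn i; rewrite /n; lia.
rewrite /n predn_expE => le; rewrite -(leq_pmul2r r0).
by move: p.-1 repunit (\sum_i digit_sum (j i)) le => b r s; lia.
Qed.

End DigitRotation.

(** Write [s = a * r]. After cancelling [r], [m] divides both [d * a] and [m * a], hence their gcd.
    This is the origin of the gcd in the bound. *)
Lemma dvdn_gcd_mul (n m r d s : nat) : n = r * m -> 0 < r -> r %| s -> n %| d * s ->
  n %| gcdn d m * s.
Proof.
move=> -> r0 /dvdnP [a ->].
rewrite [a * r]mulnC [d * _]mulnCA [gcdn d m * _]mulnCA !dvdn_pmul2l // => H.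
by rewrite muln_gcdl dvdn_gcd H dvdn_mulr.
Qed.

Local Open Scope ring_scope.

(** * Valuation on Z[z] *)

Section CyclotomicReduction.
Variables (K : fieldType) (p n : nat) (w : K) (z : algC).
Hypothesis pK : p \in [pchar K].
Hypothesis w_prim : n.-primitive_root w.
Hypothesis z_prim : (p * n).-primitive_root z.

Let p_prime : prime p. Proof. by case/andP: pK. Qed.
Let n_gt0 : (0 < n)%N. Proof. exact: prim_order_gt0 w_prim. Qed.

(** In characteristic [p], [X^(p n) - 1 = (X^n - 1)^p]; cancelling the factors with index dividing
    [n] leaves a product of cyclotomic polynomials vanishing at [w]. The index of a factor vanishing
    there is a multiple of [n] and divides [p * n] but not [n], so it is [p * n]. *)
Lemma root_Cyclotomic_mulp : (map_poly intr 'Phi_(p * n)).[w] = 0.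
Proof.
have pn0 : (0 < p * n)%N by rewrite muln_gt0 prime_gt0.
pose Phi d : {poly K} := map_poly intr 'Phi_d.
have prodPhi m : (0 < m)%N -> \prod_(d <- divisors m) Phi d = 'X^m - 1.
  by move=> m0; rewrite -rmorph_prod prod_Cyclotomic // rmorphB /= map_polyXn rmorph1.
have := prodPhi _ pn0; rewrite (bigID (fun d => d %| n)%N) /=.
have -> : \prod_(d <- divisors (p * n) | (d %| n)%N) Phi d = 'X^n - 1.
  rewrite -prodPhi // -big_filter; apply: perm_big; apply: uniq_perm.
  - by rewrite filter_uniq // divisors_uniq.
  - exact: divisors_uniq.
  move=> d; rewrite mem_filter -!dvdn_divisors //.
  by case: (boolP (d %| n)%N) => // dn; rewrite dvdn_mull.
have pKX : p \in [pchar {poly K}] by rewrite pchar_poly.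
have -> : 'X^(p * n) - 1 = ('X^n - 1) * ('X^n - 1) ^+ p.-1 :> {poly K}.
  rewrite -exprS prednK ?prime_gt0 // mulnC exprM -[in LHS](expr1n _ p).
  by rewrite -!(pFrobenius_autE pKX) -pFrobenius_autB_comm //; apply: mulrC.
have Xn0 : 'X^n - 1 != 0 :> {poly K} by rewrite -size_poly_gt0 size_XnsubC.
move/(mulfI Xn0)/(congr1 (horner^~ w)); rewrite horner_exp !hornerE (prim_expr_order w_prim) subrr.
rewrite expr0n; have -> : (p.-1 == 0%N) = false by have := prime_gt1 p_prime; lia.
rewrite horner_prod => /eqP; rewrite prodf_seq_eq0 => /hasP [d].
rewrite -dvdn_divisors // => dpn /andP [dn /eqP Pd].
have d_gt0 := dvdn_gt0 pn0 dpn.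
have wd : w ^+ d = 1.
  apply/eqP; rewrite -subr_eq0; apply/eqP.
  have := congr1 (horner^~ w) (prodPhi d d_gt0); rewrite !hornerE => <-.
  rewrite (big_rem d) -?dvdn_divisors //= hornerM.
  by rewrite /Phi Pd mul0r.
have /dvdnP [c dE] : (n %| d)%N by rewrite (prim_order_dvd w_prim) wd.
move: dpn; rewrite dE dvdn_pmul2r // => cp.
case/primeP: p_prime => _ /(_ _ cp) /pred2P [c1|cE].
  by move: dn; rewrite dE c1 mul1n dvdnn.
by rewrite -Pd dE cE.
Qed.

(** The cyclotomic polynomial is monic and minimal for [z], so it divides [P] over the integers: a
    nonzero remainder would have too small a degree to vanish at [z]. *)
Lemma reduction_well_defined (P : {poly int}) :
  (map_poly intr P).[z] = 0 -> (map_poly intr P).[w] = 0.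
Proof.
move=> Pz; set F := 'Phi_(p * n).
have Fmon : F \is monic := Cyclotomic_monic _.
have Fz : (map_poly intr F).[z] = 0.
  by apply/eqP; rewrite -/(root _ z) (Cintr_Cyclotomic z_prim) root_cyclotomic.
have PE := Pdiv.RingMonic.rdivp_eq Fmon P.
set r := Pdiv.Ring.rmodp P F in PE.
suff r0 : r = 0.
  by rewrite PE r0 addr0 rmorphM hornerM root_Cyclotomic_mulp mulr0.
apply/eqP; apply: contraT => r_neq0.
have rz : root (map_poly ratr (map_poly intr r : {poly rat}) : {poly algC}) z.
  rewrite -map_poly_comp /= (eq_map_poly (fun x => ratr_int _ x)) /root.
  by move: Pz; rewrite PE rmorphD rmorphM hornerD hornerM Fz mulr0 add0r => ->.
have [m [mE _] mP] := minCpolyP z.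
have := rz; rewrite mP => /dvdp_leq.
rewrite map_poly_eq0_id0 ?intr_eq0 ?lead_coef_eq0 // => /(_ r_neq0).
rewrite (size_map_inj_poly (@intr_inj _)) // -(size_map_poly (@ratr algC)) -mE.
rewrite (minCpoly_cyclotomic z_prim) size_cyclotomic -size_Cyclotomic -/F leqNgt.
by rewrite Pdiv.Ring.ltn_rmodpN0 // monic_neq0.
Qed.

(* [reduces_to x a]: x lies in Z[z], and the ring morphism Z[z] -> K
   mapping z to w sends it to a. *)
Definition reduces_to (x : algC) (a : K) :=
  exists P : {poly int}, x = (map_poly intr P).[z] /\ a = (map_poly intr P).[w].

Lemma reduces_to_inj x a b : reduces_to x a -> reduces_to x b -> a = b.
Proof.
move=> [P [xP ->]] [R [xR ->]]; apply/eqP; rewrite -subr_eq0 -hornerN -hornerD.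
rewrite -rmorphB reduction_well_defined // rmorphB hornerD hornerN -xP -xR.
by rewrite subrr.
Qed.

Lemma reduces_to_int (m : int) : reduces_to m%:~R m%:~R.
Proof. by exists m%:P; rewrite !map_polyC !hornerC. Qed.

Lemma reduces_to_nat (m : nat) : reduces_to m%:R m%:R.
Proof. exact: (reduces_to_int m). Qed.

Lemma reduces_to0 : reduces_to 0 0.
Proof. exact: (reduces_to_nat 0). Qed.

Lemma reduces_to1 : reduces_to 1 1.
Proof. exact: (reduces_to_nat 1). Qed.

Lemma reduces_to_root : reduces_to z w.
Proof. by exists 'X; rewrite !map_polyX !hornerX. Qed.

Lemma reduces_toD x a y b :
  reduces_to x a -> reduces_to y b -> reduces_to (x + y) (a + b).
Proof.
by move=> [P [-> ->]] [R [-> ->]]; exists (P + R); rewrite !rmorphD !hornerD.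
Qed.

Lemma reduces_toM x a y b :
  reduces_to x a -> reduces_to y b -> reduces_to (x * y) (a * b).
Proof.
by move=> [P [-> ->]] [R [-> ->]]; exists (P * R); rewrite !rmorphM !hornerM.
Qed.

Lemma reduces_toN x a : reduces_to x a -> reduces_to (- x) (- a).
Proof. by move=> [P [-> ->]]; exists (- P); rewrite !rmorphN !hornerN. Qed.

Lemma reduces_toB x a y b :
  reduces_to x a -> reduces_to y b -> reduces_to (x - y) (a - b).
Proof. by move=> xa /reduces_toN; apply: reduces_toD. Qed.

Lemma reduces_to_exp x a m : reduces_to x a -> reduces_to (x ^+ m) (a ^+ m).
Proof.
move=> xa; elim: m => [|m IH]; rewrite ?expr0 ?exprS; first exact: reduces_to1.
exact: reduces_toM.
Qed.

Lemma reduces_to_sum (I : Type) (r : seq I) (P : pred I) x a :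
  (forall i, P i -> reduces_to (x i) (a i)) ->
  reduces_to (\sum_(i <- r | P i) x i) (\sum_(i <- r | P i) a i).
Proof.
move=> xa; apply: (big_rec2 reduces_to); first exact: reduces_to0.
by move=> i y b Pi yb; apply: reduces_toD; first apply: xa.
Qed.

Lemma reduces_to_prod (I : Type) (r : seq I) (P : pred I) x a :
  (forall i, P i -> reduces_to (x i) (a i)) ->
  reduces_to (\prod_(i <- r | P i) x i) (\prod_(i <- r | P i) a i).
Proof.
move=> xa; apply: (big_rec2 reduces_to); first exact: reduces_to1.
by move=> i y b Pi yb; apply: reduces_toM; first apply: xa.
Qed.

Definition zeta : algC := z ^+ n.
Definition uniformizer : algC := 1 - zeta.

Lemma zeta_prim : p.-primitive_root zeta.
Proof.
by have := exp_prim_root z_prim n; rewrite (gcdn_idPl (dvdn_mull p (dvdnn n))) mulnK.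
Qed.

Lemma reduces_to_zeta : reduces_to zeta 1.
Proof.
by rewrite -(prim_expr_order w_prim); apply/reduces_to_exp/reduces_to_root.
Qed.

Lemma reduces_to_uniformizer : reduces_to uniformizer 0.
Proof.
rewrite -(subrr 1); apply: reduces_toB; [exact: reduces_to1|exact: reduces_to_zeta].
Qed.

Lemma uniformizer_neq0 : uniformizer != 0.
Proof.
rewrite subr_eq0 eq_sym -(prim_order_dvd zeta_prim 1) dvdn1.
by have := prime_gt1 p_prime; lia.
Qed.

(** Evaluating [(X^p - 1) / (X - 1)] at 1 gives [p] as the product of the [1 - zeta ^+ i]. The
    quotient of each by [1 - zeta] is a geometric sum that reduces to [i], nonzero in [K]. *)
Lemma prime_uniformizer :
  exists2 u, p%:R = uniformizer ^+ p.-1 * u & exists2 a, reduces_to u a & a != 0.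
Proof.
exists (\prod_(1 <= i < p) \sum_(j < i) zeta ^+ j); last first.
  exists (\prod_(1 <= i < p) i%:R).
    rewrite big_nat [X in reduces_to _ X]big_nat; apply: reduces_to_prod => i _.
    rewrite -[i in i%:R]card_ord -sumr_const; apply: reduces_to_sum => j _.
    by rewrite -(expr1n _ j); apply/reduces_to_exp/reduces_to_zeta.
  rewrite big_nat prodf_seq_neq0; apply/allP => i _; apply/implyP => /andP [i0 ip].
  by rewrite -(dvdn_pcharf pK) gtnNdvd.
have -> : uniformizer ^+ p.-1 = \prod_(1 <= i < p) uniformizer.
  by rewrite prodr_const_nat subn1.
rewrite -big_split /=.
rewrite (eq_bigr (fun i => 1 - zeta ^+ i)); last first.
  by move=> i _; rewrite -[X in X - _](expr1n _ i) subrXX; congr (_ * _);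
     apply: eq_bigr => j _; rewrite expr1n mul1r.
have := factor_Xn_sub_1 zeta_prim; rewrite big_ltn ?prime_gt0 // expr0 subrX1.
have X1 : 'X - 1%:P != 0 :> {poly algC} by rewrite polyXsubC_eq0.
move/(mulfI X1)/(congr1 (horner^~ 1)); rewrite horner_prod horner_sum.
rewrite (eq_bigr (fun=> 1) (F1 := fun i : 'I_p => _)); last first.
  by move=> i _; rewrite hornerXn expr1n.
rewrite sumr_const card_ord => <-; apply: eq_bigr => i _.
by rewrite !hornerE.
Qed.

(* [val_ge m x]: the valuation of x at the kernel of the reduction map is at
   least m, where the uniformizer 1 - zeta has valuation 1. *)
Definition val_ge m (x : algC) := exists c y,
  [/\ exists2 a, reduces_to c a & a != 0, exists b, reduces_to y b
    & c * x = uniformizer ^+ m * y].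

Lemma val_ge_reduces x a : reduces_to x a -> val_ge 0 x.
Proof.
move=> xa; exists 1, x; split; last by rewrite expr0.
  by exists 1; [exact: reduces_to1 | exact: oner_neq0].
by exists a.
Qed.

Lemma val_ge0 m : val_ge m 0.
Proof.
exists 1, 0; split; last by rewrite !mulr0.
  by exists 1; [exact: reduces_to1 | exact: oner_neq0].
by exists 0; exact: reduces_to0.
Qed.

Lemma val_ge_leq m m' x : (m <= m')%N -> val_ge m' x -> val_ge m x.
Proof.
move=> mm' [c [y [cU [b yb] cx]]]; exists c, (uniformizer ^+ (m' - m) * y).
split => //; last by rewrite mulrA -exprD subnKC.
exists (0 ^+ (m' - m) * b); apply: reduces_toM => //.
exact/reduces_to_exp/reduces_to_uniformizer.
Qed.

Lemma val_geD m x x' : val_ge m x -> val_ge m x' -> val_ge m (x + x').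
Proof.
move=> [c [y [[a ca a0] [b yb] cx]]] [c' [y' [[a' ca' a0'] [b' yb'] cx']]].
exists (c * c'), (c' * y + c * y'); split.
- by exists (a * a'); [exact: reduces_toM | exact: mulf_neq0].
- by exists (a' * b + a * b'); apply: reduces_toD; apply: reduces_toM.
transitivity (c' * (c * x) + c * (c' * x')); first by ring.
by rewrite cx cx'; ring.
Qed.

Lemma val_geM m m' x x' : val_ge m x -> val_ge m' x' -> val_ge (m + m') (x * x').
Proof.
move=> [c [y [[a ca a0] [b yb] cx]]] [c' [y' [[a' ca' a0'] [b' yb'] cx']]].
exists (c * c'), (y * y'); split.
- by exists (a * a'); [exact: reduces_toM | exact: mulf_neq0].
- by exists (b * b'); apply: reduces_toM.
by rewrite mulrACA cx cx' exprD mulrACA.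
Qed.

Lemma val_ge_sum m (I : Type) (r : seq I) (P : pred I) x :
  (forall i, P i -> val_ge m (x i)) -> val_ge m (\sum_(i <- r | P i) x i).
Proof.
by move=> xm; elim/big_ind: _ => //; [exact: val_ge0 | exact: val_geD].
Qed.

Lemma val_ge_prod (I : Type) (r : seq I) (P : pred I) m x :
  (forall i, P i -> val_ge (m i) (x i)) ->
  val_ge (\sum_(i <- r | P i) m i) (\prod_(i <- r | P i) x i).
Proof.
move=> xm; apply: (big_rec2 val_ge); first exact: val_ge_reduces reduces_to1.
by move=> i y b Pi yb; apply: val_geM; first apply: xm.
Qed.

Lemma val_ge_exp m x r : val_ge m x -> val_ge (r * m) (x ^+ r).
Proof.
move=> xm; rewrite -[r in x ^+ r]card_ord -[r in (r * m)%N]card_ord.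
by rewrite -sum_nat_const -prodr_const; apply: val_ge_prod.
Qed.

Lemma val_ge_unitl m u a x :
  reduces_to u a -> a != 0 -> val_ge m (u * x) -> val_ge m x.
Proof.
move=> ua a0 [c [y [[a' ca a0'] yb cx]]]; exists (c * u), y; split => //.
  by exists (a' * a); [exact: reduces_toM | exact: mulf_neq0].
by rewrite -mulrA.
Qed.

Lemma val_ge_prime : val_ge p.-1 p%:R.
Proof.
have [u pE [a ua _]] := prime_uniformizer.
exists 1, u; split; last by rewrite mul1r.
  by exists 1; [exact: reduces_to1 | exact: oner_neq0].
by exists a.
Qed.

Lemma val_ge_zeta_sub1 i : val_ge 1 (zeta ^+ i - 1).
Proof.
exists 1, (- (\sum_(j < i) zeta ^+ j)); split.
- by exists 1; [exact: reduces_to1 | exact: oner_neq0].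
- exists (- (\sum_(j < i) 1 ^+ j)); apply: reduces_toN; apply: reduces_to_sum.
  by move=> j _; apply/reduces_to_exp/reduces_to_zeta.
by rewrite mul1r expr1 mulrN -mulNr opprB -subrX1.
Qed.

(** For a larger [m], cancelling the uniformizer powers of [N] would equate an element with nonzero
    reduction to one that reduces to 0. *)
Lemma val_ge_nat m N : (0 < N)%N -> val_ge m N%:R -> (m <= p.-1 * logn p N)%N.
Proof.
move=> N0 [c [y [[a ca a0] [b yb] cN]]]; rewrite leqNgt; apply/negP => lt_m.
have [u pE [a' ua a0']] := prime_uniformizer.
have [r pr NE] := pfactor_coprime p_prime N0.
move: cN; rewrite NE natrM natrX pE exprMn -exprM -(subnKC (ltnW lt_m)) exprD.
set k := logn p N; set s := (p.-1 * k)%N.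
move=> cE; have H : c * r%:R * u ^+ k = uniformizer ^+ (m - s) * y.
  apply: (mulfI (expf_neq0 s uniformizer_neq0)); rewrite [RHS]mulrA -cE; ring.
have lhs : reduces_to (c * r%:R * u ^+ k) (a * r%:R * a' ^+ k).
  apply: reduces_toM; last exact: reduces_to_exp.
  by apply: reduces_toM => //; exact: reduces_to_nat.
have rhs : reduces_to (c * r%:R * u ^+ k) (0 ^+ (m - s) * b).
  by rewrite H; apply: reduces_toM => //; apply/reduces_to_exp/reduces_to_uniformizer.
have /eqP := reduces_to_inj lhs rhs.
rewrite expr0n subn_eq0 leqNgt lt_m mul0r !mulf_eq0 (negPf a0) -(dvdn_pcharf pK).
rewrite expf_eq0 (negPf a0') andbF orbF /=.
by move: pr; rewrite prime_coprime // => /negPf ->.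
Qed.

End CyclotomicReduction.

(** * Characters and Gauss sums *)

Lemma finField_prim_root (K : finFieldType) : {w : K | (#|K|.-1).-primitive_root w}.
Proof.
apply/sigW.
have [m mK] : exists m, #|K| = m.+2.
  by have := finNzRing_gt1 K; case: #|K| => [|[|m]] // _; exists m.
have : has (#|K|.-1).-primitive_root (enum (predC1 (0 : K))).
  apply: has_prim_root; first by rewrite mK.
  - apply/allP => x; rewrite mem_enum inE => x0; apply/unity_rootP.
    by apply: (mulfI x0); rewrite -exprS mulr1 -[RHS]expf_card mK.
  - exact: enum_uniq.
  by rewrite -cardE cardC1 mK.
by case/hasP => w _ wP; exists w.
Qed.

Section Characters.
Variables (K : finFieldType) (p E : nat) (w : K) (z : algC).
Hypothesis p_prime : prime p.
Hypothesis E_gt0 : (0 < E)%N.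
Hypothesis cardK : #|K| = (p ^ E)%N.
Let n := (p ^ E).-1.
Hypothesis w_prim : n.-primitive_root w.
Hypothesis z_prim : (p * n).-primitive_root z.

Let p_gt1 : (1 < p)%N := prime_gt1 p_prime.
Let p_gt0 : (0 < p)%N := prime_gt0 p_prime.
Lemma pcharK : p \in [pchar K]. Proof. exact: card_finPcharP cardK p_prime. Qed.
Let n_gt0 : (0 < n)%N. Proof. exact: prim_order_gt0 w_prim. Qed.
Let cardKn : #|K| = n.+1. Proof. by rewrite cardK prednK // expn_gt0 p_gt0. Qed.

Local Notation rd := (reduces_to w z).
Local Notation zeta := (zeta n z).
Local Notation V := (val_ge n w z).

Lemma coprime_p_n : coprime p n.
Proof.
by rewrite -(coprime_pexpl _ _ E_gt0) -cardK cardKn coprimeSn.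
Qed.

Lemma expf_unit (u : K) : u != 0 -> u ^+ n = 1.
Proof.
by move=> u0; apply: (mulfI u0); rewrite -exprS -cardKn expf_card mulr1.
Qed.

(* z reduces to w but has order p * n, whereas a Teichmuller representative must
   have order dividing n: hence the p-th powers. *)
Let v := w ^+ p.
Let tau := z ^+ p.

Let v_prim : n.-primitive_root v.
Proof.
by have := exp_prim_root w_prim p; rewrite (eqP coprime_p_n) divn1.
Qed.

Let tau_prim : n.-primitive_root tau.
Proof.
have := exp_prim_root z_prim p.
by rewrite (gcdn_idPl (dvdn_mulr n (dvdnn p))) mulKn.
Qed.

Definition Teichmuller (u : K) : algC :=
  if [pick i : 'I_n | u == v ^+ i] is Some i then tau ^+ i else 0.
Local Notation T := Teichmuller.

Lemma Teichmuller_exp i : T (v ^+ i) = tau ^+ i.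
Proof.
rewrite /T; case: pickP => [j /eqP /eqP|/(_ (Ordinal (ltn_pmod i n_gt0))) /=].
  by rewrite (eq_prim_root_expr v_prim) -(eq_prim_root_expr tau_prim) => /eqP.
by rewrite (prim_expr_mod v_prim) eqxx.
Qed.

Lemma unit_exp (u : K) : u != 0 -> exists i, u = v ^+ i.
Proof.
by move=> /expf_unit /(prim_rootP v_prim) [i ->]; exists i.
Qed.

Lemma Teichmuller0 : T 0 = 0.
Proof.
rewrite /T; case: pickP => // i; rewrite eq_sym expf_eq0.
by rewrite (prim_root_eq0 v_prim) (gtn_eqF n_gt0) andbF.
Qed.

Lemma Teichmuller1 : T 1 = 1.
Proof. by rewrite -(expr0 v) Teichmuller_exp expr0. Qed.

Lemma TeichmullerM : {morph T : x y / x * y}.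
Proof.
move=> x y; have [->|/unit_exp [i ->]] := eqVneq x 0.
  by rewrite !(mul0r, Teichmuller0).
have [->|/unit_exp [j ->]] := eqVneq y 0.
  by rewrite !(mulr0, Teichmuller0).
by rewrite -exprD !Teichmuller_exp exprD.
Qed.

Lemma TeichmullerX m : {morph T : x / x ^+ m}.
Proof.
move=> x; elim: m => [|m IH]; first by rewrite !expr0 Teichmuller1.
by rewrite !exprS TeichmullerM IH.
Qed.

Lemma Teichmuller_prod (I : Type) (r : seq I) (P : pred I) (x : I -> K) :
  T (\prod_(i <- r | P i) x i) = \prod_(i <- r | P i) T (x i).
Proof. exact: (big_morph _ TeichmullerM Teichmuller1). Qed.

Lemma reduces_to_Teichmuller u : rd (T u) u.
Proof.
have [->|/unit_exp [i ->]] := eqVneq u 0.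
  by rewrite Teichmuller0; apply: reduces_to0.
by rewrite Teichmuller_exp; do 2!apply: reduces_to_exp; apply: reduces_to_root.
Qed.

Lemma Teichmuller_expn u : u != 0 -> T u ^+ n = 1.
Proof. by move=> u0; rewrite -TeichmullerX expf_unit // Teichmuller1. Qed.

(** Substituting [u * x] multiplies the sum by [T u ^+ m], which differs from 1 because its
    reduction [u ^+ m] does. *)
Lemma sum_Teichmuller_eq0 (A : {pred K}) u m :
  u != 0 -> (forall x, (u * x \in A) = (x \in A)) -> u ^+ m != 1 ->
  \sum_(x in A) T x ^+ m = 0.
Proof.
move=> u0 uA um1; set S := LHS.
have : S = T u ^+ m * S.
  rewrite {1}/S (reindex (fun x => u * x)) /=; last first.
    by apply: onW_bij; exists (fun x => u^-1 * x) => x; rewrite ?mulKf ?mulVKf.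
  rewrite /S mulr_sumr; under eq_bigl do rewrite uA.
  by apply: eq_bigr => x _; rewrite TeichmullerM exprMn.
move/eqP; rewrite -subr_eq0 -{1}[S]mul1r -mulrBl mulf_eq0 => /orP [|/eqP //].
rewrite subr_eq0 => /eqP Tu; case/eqP: um1.
have := reduces_to_exp m (reduces_to_Teichmuller u); rewrite -Tu => ru.
exact: (reduces_to_inj pcharK w_prim z_prim ru (reduces_to1 w z)).
Qed.

(** At [m = 0] the convention [0 ^+ 0 = 1] counts 0 as well, giving [p ^ E] instead of [n]: this is
    the extra valuation earned by the zero columns of [digit_weight_bound]. *)
Lemma sum_Teichmuller m :
  \sum_u T u ^+ m =
    if m == 0%N then (p ^ E)%:R else if (n %| m)%N then n%:R else 0.
Proof.
case: eqP => [->|/eqP m0].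
  by under eq_bigr do rewrite expr0; rewrite sumr_const cardK.
case: (boolP (n %| m)%N) => [/dvdnP [c mE]|nm].
  rewrite (bigD1 0) //= Teichmuller0 expr0n (negPf m0) add0r.
  rewrite (eq_bigr (fun=> 1)) ?sumr_const ?cardC1 ?cardKn // => u u0.
  by rewrite mE mulnC exprM Teichmuller_expn // expr1n.
apply: (@sum_Teichmuller_eq0 predT w) => //.
  by rewrite (prim_root_eq0 w_prim) (gtn_eqF n_gt0).
by rewrite -(prim_order_dvd w_prim).
Qed.

Lemma sum_exp m : (0 < m)%N ->
  \sum_(u : K) u ^+ m = if (n %| m)%N then n%:R else 0.
Proof.
move=> m0; apply: (reduces_to_inj pcharK w_prim z_prim (x := \sum_u T u ^+ m)).
  by apply: reduces_to_sum => u _; apply/reduces_to_exp/reduces_to_Teichmuller.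
rewrite sum_Teichmuller gtn_eqF //; case: ifP => _.
  exact: reduces_to_nat.
exact: reduces_to0.
Qed.

(** * The absolute trace and the additive character *)

Definition trace (u : K) : K := \sum_(h < E) u ^+ (p ^ h).

Lemma exprD_pchar h : {morph (fun u : K => u ^+ (p ^ h)) : x y / x + y}.
Proof.
by move=> x y; apply: exprDn_pchar; rewrite pnatX pnatE // pcharK.
Qed.

Lemma traceD : {morph trace : x y / x + y}.
Proof.
move=> x y; rewrite /trace -big_split /=; apply: eq_bigr => h _; exact: exprD_pchar.
Qed.

Lemma trace_shift u : \sum_(h < E) u ^+ (p ^ h.+1) = trace u.
Proof.
apply: (@addrI _ (u ^+ (p ^ 0))).
rewrite -(big_ord_recl E (fun h : 'I_E.+1 => u ^+ (p ^ h))) big_ord_recr /=.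
by rewrite -cardK expf_card expn0 expr1 addrC.
Qed.

Lemma trace_Frobenius u : trace (u ^+ p) = trace u.
Proof.
rewrite -[RHS]trace_shift; apply: eq_bigr => h _.
by rewrite -exprM -expnS.
Qed.

Lemma trace_expp u : trace u ^+ p = trace u.
Proof.
rewrite -[RHS]trace_shift /trace -(pFrobenius_autE pcharK) rmorph_sum /=.
by apply: eq_bigr => h _; rewrite pFrobenius_autE -exprM -expnSr.
Qed.

Lemma natr_inj_pchar i j : (i < p)%N -> (j < p)%N -> i%:R = j%:R :> K -> i = j.
Proof.
wlog ij : i j / (i <= j)%N.
  by move=> H ip jp; case: (leqP i j) => [/H|/ltnW /H H'] => [|/esym /H' ->]; auto.
move=> _ jp /eqP; rewrite eq_sym -subr_eq0 -natrB // -(dvdn_pcharf pcharK).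
move=> d; apply/eqP; rewrite eqn_leq ij -subn_eq0 /=; apply: contraLR d => d0.
by rewrite gtnNdvd ?lt0n //; lia.
Qed.

Lemma prime_subfield (x : K) : x ^+ p = x -> exists i : 'I_p, x = i%:R.
Proof.
move=> xp; pose rs := [seq ((val i)%:R : K) | i : 'I_p].
have [/mapP [i _ ->]|xrs] := boolP (x \in rs); first by exists i.
pose P : {poly K} := 'X^p - 'X.
have sP : size P = p.+1.
  by rewrite size_polyDl ?size_polyXn // size_polyN size_polyX ltnS.
have : (size (x :: rs) < size P)%N.
  apply: max_poly_roots; first by rewrite -size_poly_gt0 sP.
  - rewrite /= /root !hornerE xp subrr eqxx /=; apply/allP => _ /mapP [i _ ->].
    by rewrite /root !hornerE -(pFrobenius_autE pcharK) pFrobenius_aut_nat subrr.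
  rewrite /= xrs map_inj_uniq ?enum_uniq // => i j ij.
  exact/val_inj/(natr_inj_pchar (ltn_ord i) (ltn_ord j) ij).
by rewrite sP /= size_map size_enum_ord ltnn.
Qed.

Lemma trace_neq0 : exists u, trace u != 0.
Proof.
apply/existsP; apply: contraT; rewrite negb_exists => /forallP tr0.
pose P : {poly K} := \sum_(h < E) 'X^(p ^ h).
have P0 : P != 0.
  apply/eqP => /(congr1 (fun P : {poly K} => P`_1)); rewrite coef0 coef_sum.
  rewrite (bigD1 (Ordinal E_gt0)) //= coefXn expn0 eqxx big1 ?addr0 => [/eqP|i].
    by rewrite oner_eq0.
  rewrite -val_eqE /= => i0; rewrite coefXn; case: eqP => // pi.
  by have := ltn_expl i p_gt1; move: i0; rewrite -pi; case: (nat_of_ord i).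
have : (size (enum K) < size P)%N.
  apply: max_poly_roots => //; last exact: enum_uniq.
  apply/allP => u _; rewrite /root horner_sum.
  by under eq_bigr do rewrite hornerXn; have := tr0 u; rewrite negbK.
rewrite -cardE cardK ltnNge (leq_trans (size_sum _ _ _)) //.
apply/bigmax_leqP => h _; rewrite size_polyXn ltn_exp2l //; exact: ltn_ord.
Qed.

(** The trace is fixed by Frobenius, hence lies in the prime field, and the default 0 is never
    reached. *)
Definition psi (u : K) : algC :=
  if [pick i : 'I_p | trace u == i%:R] is Some i then zeta ^+ i else 0.

Lemma psiP u i : trace u = i%:R -> psi u = zeta ^+ i.
Proof.
have zp := zeta_prim w_prim z_prim.
move=> tui; rewrite /psi; case: pickP => [j|/(_ (Ordinal (ltn_pmod i p_gt0))) /=].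
  rewrite tui => /eqP ij; apply/eqP; rewrite (eq_prim_root_expr zp).
  rewrite eq_sym -(modn_small (ltn_ord j)); apply/eqP.
  apply: natr_inj_pchar; rewrite ?ltn_pmod //.
  by rewrite !(GRing.natr_mod_pchar pcharK).
by rewrite tui (GRing.natr_mod_pchar pcharK) eqxx.
Qed.

Lemma psi_exists u : exists2 i, trace u = i%:R & psi u = zeta ^+ i.
Proof.
have [i ti] := prime_subfield (trace_expp u).
by exists i => //; apply: psiP.
Qed.

Lemma psiD u x : psi (u + x) = psi u * psi x.
Proof.
have [i ti ->] := psi_exists u; have [j tj ->] := psi_exists x.
by rewrite -exprD; apply: psiP; rewrite traceD ti tj natrD.
Qed.

Lemma psi0 : psi 0 = 1.
Proof.
apply: (@psiP _ 0); rewrite /trace big1 // => h _.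
by rewrite expr0n expn_eq0 (gtn_eqF p_gt0).
Qed.

Lemma psi_sum (I : Type) (r : seq I) (P : pred I) (x : I -> K) :
  psi (\sum_(i <- r | P i) x i) = \prod_(i <- r | P i) psi (x i).
Proof. exact: (big_morph _ psiD psi0). Qed.

Lemma psi_Frobenius u : psi (u ^+ p) = psi u.
Proof.
by have [i ti ->] := psi_exists u; apply: psiP; rewrite trace_Frobenius.
Qed.

Lemma psi_neq1 : exists u, psi u != 1.
Proof.
have [u tu] := trace_neq0; exists u; have [i ti ->] := psi_exists u.
rewrite -(prim_order_dvd (zeta_prim w_prim z_prim)).
by rewrite (dvdn_pcharf pcharK) -ti.
Qed.

Lemma reduces_to_psi u : rd (psi u) 1.
Proof.
have [i _ ->] := psi_exists u; rewrite -(expr1n _ i).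
exact/reduces_to_exp/reduces_to_zeta.
Qed.

Lemma val_ge_psi_sub1 u : V 1 (psi u - 1).
Proof. by have [i _ ->] := psi_exists u; exact: val_ge_zeta_sub1. Qed.

Lemma sum_psiM c : \sum_u psi (c * u) = if c == 0 then (p ^ E)%:R else 0.
Proof.
case: eqP => [->|/eqP c0].
  by under eq_bigr do rewrite mul0r psi0; rewrite sumr_const cardK.
rewrite (reindex (fun x => c^-1 * x)) /=; last first.
  by apply: onW_bij; exists (fun x => c * x) => x; rewrite ?mulKf ?mulVKf.
under eq_bigr do rewrite mulVKf //.
have [u pu] := psi_neq1; set S := LHS.
have : S = psi u * S.
  rewrite {1}/S (reindex (fun x => u + x)) /=; last first.
    by apply: onW_bij; exists (fun x => - u + x) => x; rewrite ?addKr ?addNKr.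
  by rewrite mulr_sumr; apply: eq_bigr => x _; rewrite psiD.
move/eqP; rewrite -subr_eq0 -{1}[S]mul1r -mulrBl mulf_eq0 => /orP [|/eqP //].
by rewrite subr_eq0 eq_sym (negPf pu).
Qed.

Lemma psi_neq0 u : psi u != 0.
Proof.
apply/eqP => pu; have := psi0; rewrite -(subrr u) psiD pu mul0r => /eqP.
by rewrite eq_sym oner_eq0.
Qed.

(** * The equation [y ^+ q - y = c] *)

Section ArtinSchreier.
Variable e : nat.
Let q := (p ^ e)%N.

Lemma exprBq : {morph (fun u : K => u ^+ q) : x y / x - y}.
Proof.
move=> x y; apply: (@addIr _ (y ^+ q)).
by rewrite /= -(exprD_pchar e (x - y) y) !subrK.
Qed.

Lemma psi_expq u : psi (u ^+ q) = psi u.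
Proof.
rewrite /q; elim: e => [|h IH]; first by rewrite expr1.
by rewrite expnS mulnC exprM psi_Frobenius.
Qed.

Lemma sum_card_preim (f : K -> K) : (\sum_c #|[pred y | f y == c]| = p ^ E)%N.
Proof.
rewrite -cardK -[RHS]sum1_card [RHS](partition_big f predT) //=.
by apply: eq_bigr => c _; rewrite -sum1_card; apply: eq_bigl => y; rewrite inE.
Qed.

Lemma card_Artin_Schreier_image y :
  #|[pred x : K | x ^+ q - x == y ^+ q - y]| = #|[pred t : K | t ^+ q == t]|.
Proof.
have bij : bijective (fun x => x - y).
  by exists (fun x => x + y) => x; rewrite ?subrK ?addrK.
rewrite -(on_card_preimset (onW_bij [pred t : K | t ^+ q == t] bij)).
apply: eq_card => x; rewrite !inE exprBq -subr_eq0 -[RHS]subr_eq0.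
by congr (_ == 0); ring.
Qed.

(** The nonempty fibres of an additive map all have the size of its kernel, so this size is a power
    of [p]; it exceeds 1 because 0 and 1 are fixed. *)
Lemma dvdn_card_fixed : (p %| #|[pred t : K | t ^+ q == t]|)%N.
Proof.
set N := #|_|.
have : (N %| p ^ E)%N.
  rewrite -(sum_card_preim (fun x => x ^+ q - x)); apply: dvdn_sum => c _.
  have [y /eqP <-|N0] := pickP [pred y : K | y ^+ q - y == c].
    by rewrite card_Artin_Schreier_image.
  by rewrite eq_card0 // dvdn0.
case/(dvdn_pfactor _ _ p_prime) => -[|i] _ NE; last by rewrite NE expnS dvdn_mulr.
pose s : seq K := [:: 0; 1].
have : (#|s| <= N)%N.
  apply/subset_leq_card/subsetP => x; rewrite !inE => /orP [] /eqP ->.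
    by rewrite expr0n expn_eq0 (gtn_eqF p_gt0).
  by rewrite expr1n.
rewrite NE (card_uniqP _) //= inE eq_sym oner_eq0 //.
Qed.

(** On the image of [y ^+ q - y] both sides equal the number of fixed points. Off the image the left
    side is 0 and the right side, a character sum over an additive group, is nonnegative. Both have
    total [p ^ E] over all [c], so the termwise inequality is an equality. *)
Lemma card_Artin_Schreier c :
  #|[pred y : K | y ^+ q - y == c]|%:R = \sum_(t : K | t ^+ q == t) psi (t * c).
Proof.
pose F := [pred t : K | t ^+ q == t].
pose N c := #|[pred y : K | y ^+ q - y == c]|.
pose A c := \sum_(t in F) psi (t * c).
have N_img y : N (y ^+ q - y) = #|F| := card_Artin_Schreier_image y.
have A_img y : A (y ^+ q - y) = #|F|%:R.
  rewrite /A (eq_bigr (fun=> 1)) ?sumr_const // => t /eqP tF.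
  apply: (mulIf (psi_neq0 (t * y))).
  by rewrite -psiD mulrBr -{1}tF -exprMn subrK psi_expq mul1r.
have A_ge0 c' : (N c')%:R <= A c'.
  have [y /eqP <-|N0] := pickP [pred y : K | y ^+ q - y == c'].
    by rewrite N_img A_img.
  rewrite /N eq_card0 //; have [/forallP Ft|] := boolP [forall t in F, psi (t * c') == 1].
    rewrite /A (eq_bigr (fun=> 1)) ?sumr_const ?ler0n // => t tF.
    by have := Ft t; rewrite tF => /eqP.
  rewrite negb_forall => /existsP [t]; rewrite negb_imply => /andP [/eqP tF pt].
  suff -> : A c' = 0 by [].
  have : A c' = psi (t * c') * A c'.
    rewrite {1}/A (reindex (fun x => t + x)) /=; last first.
      by apply: onW_bij; exists (fun x => - t + x) => x; rewrite ?addKr ?addNKr.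
    rewrite mulr_sumr; apply: eq_big => [x|x _]; last by rewrite mulrDl psiD.
    by rewrite !inE (exprD_pchar e t x) tF (inj_eq (addrI t)).
  move/eqP; rewrite -subr_eq0 -{1}[A c']mul1r -mulrBl mulf_eq0 => /orP [|/eqP //].
  by rewrite subr_eq0 eq_sym (negPf pt).
have F0 : 0 \in F by rewrite inE expr0n expn_eq0 (gtn_eqF p_gt0).
have sumA : \sum_c A c = (p ^ E)%:R.
  rewrite exchange_big /= (bigD1 0) //= sum_psiM eqxx big1 ?addr0 // => t.
  by case/andP => _ t0; rewrite sum_psiM (negPf t0).
have : \sum_c (A c - (N c)%:R) == 0.
  by rewrite sumrB sumA -natr_sum sum_card_preim subrr.
rewrite psumr_eq0 => [|c' _]; last by rewrite subr_ge0.
by move/allP/(_ c (mem_index_enum c)); rewrite subr_eq0 => /eqP <-.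
Qed.

End ArtinSchreier.

(** * Gauss sums and the easy half of Stickelberger's theorem *)

Definition gauss j := \sum_u psi u * T u ^+ (n - j).

Lemma Teichmuller0X m : (0 < m)%N -> T 0 ^+ m = 0.
Proof. by move=> m0; rewrite Teichmuller0 expr0n (gtn_eqF m0). Qed.

(** Substitute [u ^+ p] for [u]: [psi] is unchanged, and the exponents [p * (n - j)] and [n - p * j]
    agree modulo [n]. *)
Lemma gauss_mulp j : (p * j < n)%N -> gauss (p * j) = gauss j.
Proof.
move=> pjn; rewrite /gauss [RHS](reindex (fun u => u ^+ p)) /=; last first.
  by apply/onW_bij/injF_bij => x y; rewrite -!(pFrobenius_autE pcharK) => /fmorph_inj.
apply: eq_bigr => u _; rewrite psi_Frobenius; congr (_ * _).
rewrite TeichmullerX -exprM; have jn : (j < n)%N by nia.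
have [->|u0] := eqVneq u 0.
  by rewrite !Teichmuller0X ?muln_gt0 ?p_gt0 ?subn_gt0.
have -> : (p * (n - j) = n * p.-1 + (n - p * j))%N by nia.
by rewrite exprD [T u ^+ (n * _)]exprM Teichmuller_expn // expr1n mul1r.
Qed.

(** The Jacobi sum of the characters [T^(-1)] and [T^(-j)]. *)
Definition jacobi1 j := \sum_u T u ^+ n.-1 * T (1 - u) ^+ (n - j).

(** Group the double sum by the sum [s] of the two arguments. The terms with [s = 0] cancel because
    [n] does not divide [j + 1]; for the others, scaling [u] by [s] extracts the Jacobi sum. *)
Lemma gauss1M j : (0 < j)%N -> (j.+1 < n)%N ->
  gauss 1 * gauss j = jacobi1 j * gauss j.+1.
Proof.
move=> j0 jn; rewrite /gauss mulr_suml mulr_sumr.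
transitivity (\sum_u \sum_s psi s * (T u ^+ n.-1 * T (s - u) ^+ (n - j))).
  apply: eq_bigr => u _; rewrite mulr_sumr (reindex (fun s => s - u)) /=; last first.
    by apply: onW_bij; exists (fun s => s + u) => x; rewrite ?addrK ?subrK.
  apply: eq_bigr => s _; have -> : psi s = psi (s - u) * psi u by rewrite -psiD subrK.
  by rewrite subn1; ring.
rewrite exchange_big /=; apply: eq_bigr => s _; rewrite -mulr_sumr mulrCA; congr (_ * _).
have [->|s0] := eqVneq s 0.
  rewrite Teichmuller0X ?subn_gt0 // mulr0.
  transitivity (T (-1) ^+ (n - j) * \sum_u T u ^+ (n.-1 + (n - j))).
    rewrite mulr_sumr; apply: eq_bigr => u _.
    by rewrite sub0r -(mulN1r u) TeichmullerM exprMn exprD mulrCA.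
  have -> : (n.-1 + (n - j) = n + (n - j.+1))%N by lia.
  rewrite sum_Teichmuller addn_eq0 (gtn_eqF n_gt0) dvdn_addr // gtnNdvd ?mulr0 //.
    by rewrite subn_gt0.
  by lia.
rewrite (reindex (fun u => s * u)) /=; last first.
  by apply: onW_bij; exists (fun x => s^-1 * x) => x; rewrite ?mulKf ?mulVKf.
rewrite /jacobi1 mulr_suml; apply: eq_bigr => u _.
rewrite -{2}[s]mulr1 -mulrBr !TeichmullerM !exprMn mulrACA mulrC; congr (_ * _).
rewrite -exprD; have -> : (n.-1 + (n - j) = n + (n - j.+1))%N by lia.
by rewrite exprD Teichmuller_expn // mul1r.
Qed.

Lemma natr_n : n%:R = -1 :> K.
Proof.
apply: (@addIr _ 1); rewrite addNr -(natrD _ n 1) addn1 -cardKn cardK natrX.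
by rewrite (pcharf0 pcharK) expr0n (gtn_eqF E_gt0).
Qed.

(** In the binomial expansion only [i = 1] survives: [n] must divide [n.-1 + i], and
    [i <= n - j < n]. The sign of that term cancels the sum of the [u ^+ n], which is -1. *)
Lemma reduces_to_jacobi1 j : (0 < j)%N -> (j.+1 < n)%N ->
  rd (jacobi1 j) (n - j)%:R.
Proof.
move=> j0 jn.
suff <- : \sum_u u ^+ n.-1 * (1 - u) ^+ (n - j) = (n - j)%:R :> K.
  apply: reduces_to_sum => u _; apply: reduces_toM; apply: reduces_to_exp.
    exact: reduces_to_Teichmuller.
  exact: reduces_to_Teichmuller.
transitivity (\sum_(i < (n - j).+1)
    (-1) ^+ i * 'C(n - j, i)%:R * \sum_u (u : K) ^+ (n.-1 + i)).
  under [RHS]eq_bigr do rewrite mulr_sumr.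
  rewrite exchange_big /=; apply: eq_bigr => u _.
  rewrite exprBn mulr_sumr; apply: eq_bigr => i _.
  by rewrite expr1n exprD -mulr_natl; ring.
have i1 : (1 < (n - j).+1)%N by lia.
rewrite (bigD1 (Ordinal i1)) //= sum_exp; last by lia.
have -> : (n.-1 + 1 = n)%N by lia.
rewrite dvdnn natr_n bin1 big1 ?addr0; first by ring.
move=> i; rewrite -val_eqE /= => i_neq1; have := ltn_ord i => i_lt.
rewrite sum_exp; last by lia.
case: ifP => [/dvdnP [c]|]; last by rewrite mulr0.
by case: c => [|[|c]]; nia.
Qed.

Lemma val_ge_gauss1 : (1 < n)%N -> V 1 (gauss 1).
Proof.
move=> n1; have -> : gauss 1 = \sum_u (psi u - 1) * T u ^+ (n - 1).
  under [RHS]eq_bigr do rewrite mulrBl mul1r.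
  rewrite sumrB sum_Teichmuller subn_eq0 leqNgt n1 gtnNdvd ?subr0 ?subn_gt0 //.
  by lia.
apply: val_ge_sum => u _; rewrite -[1%N]addn0.
apply: val_geM; first exact: val_ge_psi_sub1.
exact/val_ge_reduces/reduces_to_exp/reduces_to_Teichmuller.
Qed.

(** Induction along the digits: Frobenius removes a zero lowest digit, and otherwise [gauss1M] gains
    the valuation of [gauss 1]. The Jacobi sum is a unit because [n - j = p ^ E - (j + 1)] is prime
    to [p]. *)
Lemma val_ge_gauss j : (j < n)%N -> V (digit_sum p E j) (gauss j).
Proof.
elim/ltn_ind: j => -[_ _|j IH jn].
  rewrite digit_sum0; apply: (val_ge_reduces _ (a := \sum_u 1 * u ^+ (n - 0))).
  apply: reduces_to_sum => u _; apply: reduces_toM; first exact: reduces_to_psi.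
  exact/reduces_to_exp/reduces_to_Teichmuller.
have nE : (n < p ^ E)%N by rewrite -cardK cardKn.
have [/dvdnP [i ij]|pj] := boolP (p %| j.+1)%N.
  have ltij : (i < j.+1)%N by rewrite ij ltn_Pmulr //; lia.
  have lt_in := ltn_trans ltij jn.
  rewrite ij mulnC digit_sum_mulp ?(ltn_trans lt_in) // gauss_mulp; first exact: IH.
  by rewrite mulnC -ij.
rewrite digit_sumS //; have [j0|j0] := posnP j.
  by rewrite j0 digit_sum0; apply: val_ge_gauss1; rewrite -j0.
apply: (val_ge_unitl (reduces_to_jacobi1 j0 jn)); last first.
  rewrite -gauss1M // -add1n; apply: val_geM; last by apply: IH; lia.
  by apply: val_ge_gauss1; lia.
rewrite -(dvdn_pcharf pcharK); apply: contra pj.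
have -> : (n - j = p ^ E - j.+1)%N by rewrite -cardK cardKn subSS.
by rewrite dvdn_subr ?dvdn_exp //; lia.
Qed.

(* Since [0 ^+ 0 = 1], the expansion of psi in powers of T also holds at 0, at
   the cost of splitting the trivial character into the exponents 0 and n. *)
Definition psi_coef j : algC :=
  if j == 0%N then n%:R else if j == n then - (p ^ E)%:R else gauss j.

(** Fourier inversion on the multiplicative group, with the denominator [n] cleared. *)
Lemma psi_expand u : n%:R * psi u = \sum_(j < n.+1) psi_coef j * T u ^+ j.
Proof.
have [->|u0] := eqVneq u 0.
  rewrite big_ord_recl expr0 /psi_coef eqxx psi0 big1 ?addr0 // => j _.
  by rewrite Teichmuller0X // mulr0.
have g0 : gauss 0 = -1.
  rewrite /gauss subn0 (bigD1 0) //= Teichmuller0X // mulr0 add0r.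
  have := sum_psiM 1; rewrite oner_eq0 (bigD1 0) //= mulr0 psi0 => /eqP.
  rewrite addrC addr_eq0 => /eqP <-; apply: eq_bigr => x x0.
  by rewrite Teichmuller_expn // mul1r mulr1.
have main : \sum_(j < n) gauss j * T u ^+ j = n%:R * psi u.
  under eq_bigr do rewrite /gauss mulr_suml.
  rewrite exchange_big /= (bigD1 u) //= [X in _ + X]big1 ?addr0 => [|x xu].
    transitivity (\sum_(j < n) psi u); last by rewrite sumr_const card_ord mulr_natl.
    apply: eq_bigr => j _; rewrite -mulrA -exprD subnK ?Teichmuller_expn ?mulr1 //.
    exact: ltnW.
  have [->|x0] := eqVneq x 0.
    by rewrite big1 // => j _; rewrite Teichmuller0X ?subn_gt0 // mulr0 mul0r.
  have xK : T x * T x^-1 = 1 by rewrite -TeichmullerM mulfV // Teichmuller1.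
  transitivity (psi x * \sum_(j < n) T (u / x) ^+ j).
    rewrite mulr_sumr; apply: eq_bigr => j _; rewrite -mulrA; congr (_ * _).
    rewrite TeichmullerM exprMn mulrC; congr (_ * _).
    rewrite -[LHS]mulr1 -(expr1n _ j) -xK exprMn mulrA -exprD subnK ?Teichmuller_expn ?mul1r //.
    exact: ltnW.
  have := subrX1 (T (u / x)) n; rewrite Teichmuller_expn; last first.
    by rewrite mulf_neq0 // invr_neq0.
  rewrite subrr => /esym/eqP; rewrite mulf_eq0 => /orP [|/eqP ->]; last by rewrite mulr0.
  rewrite subr_eq0 => /eqP Tux; case/eqP: xu; apply: (mulIf (invr_neq0 x0)).
  rewrite mulfV //; apply/esym; apply: (reduces_to_inj pcharK w_prim z_prim).
    exact: reduces_to_Teichmuller.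
  rewrite Tux; exact: reduces_to1.
(* For [u != 0] both [T u ^+ 0] and [T u ^+ n] are 1, and their coefficients [n] and [- p ^ E] add
   up to [gauss 0 = -1]. *)
rewrite -main big_ord_recr /= {2}/psi_coef eqxx (gtn_eqF n_gt0) Teichmuller_expn // mulr1.
rewrite (bigD1 (Ordinal n_gt0)) //= [in RHS](bigD1 (Ordinal n_gt0)) //=.
rewrite g0 /psi_coef eqxx expr0 !mulr1 -[RHS]addrA [_ + - _]addrC addrA.
congr (_ + _); last first.
  apply: eq_bigr => j; rewrite -val_eqE /= => /negPf ->.
  by rewrite (ltn_eqF (ltn_ord j)).
by rewrite -cardK cardKn -addn1 natrD opprD addNKr.
Qed.

Lemma val_ge_card : V (E * p.-1) (p ^ E)%:R.
Proof.
by rewrite natrX; apply: val_ge_exp; apply: (val_ge_prime pcharK w_prim z_prim).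
Qed.

(** The coefficient at [n] fits because all [E] digits of [n] are [p - 1], while [p ^ E] has
    valuation [E * p.-1]. *)
Lemma val_ge_psi_coef j : (j <= n)%N -> V (digit_sum p E j) (psi_coef j).
Proof.
move=> jn; rewrite /psi_coef; case: eqP => [->|_].
  by rewrite digit_sum0; apply/val_ge_reduces/reduces_to_nat.
case: eqP => [->|/eqP jn']; last by apply: val_ge_gauss; rewrite ltn_neqAle jn'.
rewrite digit_sum_max // -mulN1r -[(E * p.-1)%N]add0n.
apply: val_geM val_ge_card.
exact/val_ge_reduces/reduces_toN/reduces_to1.
Qed.

(** * Character sums of a polynomial expanded in monomials *)

Section Monomials.
Variables (e m k d M C : nat) (a : 'I_M -> K) (D : 'I_M -> 'I_k -> nat).
Hypothesis e_gt0 : (0 < e)%N.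
Hypothesis E_def : E = (e * m)%N.
Hypothesis d_gt0 : (0 < d)%N.
Hypothesis sumD : forall i, (\sum_l D i l = d)%N.
Let q := (p ^ e)%N.
Let g := gcdn d (n %/ q.-1).
Hypothesis leC : forall A, (g * k <= d * A -> C <= A)%N.

Let f (x : {ffun 'I_k -> K}) := \sum_i a i * \prod_l x l ^+ D i l.

Let q_gt1 : (1 < q)%N.
Proof. by rewrite -(expn0 p) ltn_exp2l. Qed.

Let q1_dvd_n : (q.-1 %| n)%N.
Proof. by rewrite /n E_def expnM predn_exp dvdn_mulr. Qed.

Lemma sum_subfield_Teichmuller s :
  ~~ (q.-1 %| s)%N -> \sum_(t in [pred t | t ^+ q == t]) T t ^+ s = 0.
Proof.
move=> qs; have q0 : (0 < q.-1)%N by lia.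
have w0 : w != 0 by rewrite (prim_root_eq0 w_prim) (gtn_eqF n_gt0).
pose u := w ^+ (n %/ q.-1).
have u0 : u != 0 by rewrite expf_neq0.
have uq : u ^+ q = u.
  rewrite -(@prednK q) ?(ltnW q_gt1) // exprS -exprM divnK //.
  by rewrite (prim_expr_order w_prim) mulr1.
apply: (sum_Teichmuller_eq0 (u := u)) => // [x|].
  by rewrite !inE exprMn uq (inj_eq (mulfI u0)).
rewrite -exprM -(prim_order_dvd w_prim).
apply: contra qs => nd; rewrite -(dvdn_pmul2l (_ : 0 < n %/ q.-1)%N) ?divnK //.
by rewrite divn_gt0 // dvdn_leq.
Qed.

Lemma expand_psi_poly x t :
  n%:R ^+ M * psi (t * f x) =
  \sum_(J : {ffun 'I_M -> 'I_n.+1})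
    (\prod_i (psi_coef (J i) * T (a i) ^+ J i)) * T t ^+ (\sum_i J i) *
    \prod_l T (x l) ^+ (\sum_i J i * D i l).
Proof.
rewrite /f mulr_sumr psi_sum -[M in _ ^+ M]card_ord -prodr_const -big_split /=.
under eq_bigr do rewrite psi_expand.
rewrite bigA_distr_bigA /=; apply: eq_bigr => J _.
under [X in _ * X]eq_bigr do rewrite expr_sum.
rewrite exchange_big /= expr_sum -!big_split /=; apply: eq_bigr => i _.
rewrite !TeichmullerM !exprMn Teichmuller_prod -prodrXl.
have -> : \prod_l T (x l ^+ D i l) ^+ J i = \prod_l T (x l) ^+ (J i * D i l).
  by apply: eq_bigr => l _; rewrite TeichmullerX -exprM mulnC.
ring.
Qed.

(** The factor [n ^ M] of the expansion is a unit, as [n] reduces to -1. For each [J] the sums over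
    [t] and over the coordinates separate, and [digit_weight_bound] handles every [J] whose sums do
    not vanish. *)
Lemma val_ge_sum_psi v0 :
    (forall s, (E * p.-1 * C <= g * s -> v0 <= s)%N) ->
  V v0 (\sum_(x : {ffun 'I_k -> K}) \sum_(t : K | t ^+ q == t) psi (t * f x)).
Proof.
move=> lev0; apply: (@val_ge_unitl _ _ _ _ _ (n%:R ^+ M) ((-1) ^+ M)).
- by rewrite -natr_n; apply/reduces_to_exp/reduces_to_nat.
- by rewrite signr_eq0.
rewrite mulr_sumr; under eq_bigr do rewrite mulr_sumr.
under eq_bigr => x _ do under eq_bigr do rewrite expand_psi_poly.
under eq_bigr do rewrite exchange_big /=.
rewrite exchange_big /=; apply: val_ge_sum => J _.
pose col l := (\sum_i J i * D i l)%N.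
have -> : \sum_(x : {ffun 'I_k -> K}) \sum_(t | t ^+ q == t)
      (\prod_i (psi_coef (J i) * T (a i) ^+ J i)) * T t ^+ (\sum_i J i) *
      \prod_l T (x l) ^+ col l =
    (\prod_i (psi_coef (J i) * T (a i) ^+ J i)) *
    (\sum_(t in [pred t | t ^+ q == t]) T t ^+ (\sum_i J i)) *
    \prod_l \sum_u T u ^+ col l.
  rewrite bigA_distr_bigA /= [RHS]mulr_sumr; apply: eq_bigr => x _.
  by rewrite mulr_sumr mulr_suml.
have [qJ|/sum_subfield_Teichmuller ->] := boolP (q.-1 %| \sum_i J i)%N; last first.
  by rewrite mulr0 mul0r; apply: val_ge0.
have [/forallP dvd_col|] := boolP [forall l, n %| col l]%N; last first.
  rewrite negb_forall => /existsP [l nl]; rewrite (bigD1 l) //= sum_Teichmuller.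
  rewrite (negPf nl); case: eqP nl => [->|_ _]; first by rewrite dvdn0.
  by rewrite mul0r mulr0; apply: val_ge0.
(* By homogeneity the column sums add up to [d] times the total of [J], so [n] divides that; the sum
   over [t] makes [q.-1] divide the total itself. *)
have n_dvd : (n %| g * \sum_i J i)%N.
  apply: (dvdn_gcd_mul (r := q.-1)) => //; first by rewrite mulnC divnK.
    by lia.
  have -> : (d * \sum_i J i = \sum_l col l)%N.
    rewrite exchange_big mulnC big_distrl /=; apply: eq_bigr => i _.
    by rewrite -big_distrr /= sumD.
  by apply: dvdn_sum => l _.
have Jn i : (J i <= n)%N by rewrite -ltnS.
have := digit_weight_bound p_gt1 E_gt0 d_gt0 leC Jn sumD dvd_col n_dvd.
set Z := #|_|; move=> /lev0 /(val_ge_leq w_prim); apply.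
rewrite -[X in (X + _)%N]addn0; apply: val_geM; first apply: val_geM.
- apply: val_ge_prod => i _; rewrite -[X in V X]addn0.
  apply: val_geM; first exact: val_ge_psi_coef.
  exact/val_ge_reduces/reduces_to_exp/reduces_to_Teichmuller.
- apply: (val_ge_reduces _ (a := \sum_(t in [pred t | t ^+ q == t]) t ^+ (\sum_i J i))).
  apply: reduces_to_sum => t _.
  exact/reduces_to_exp/reduces_to_Teichmuller.
have -> : (E * p.-1 * Z = \sum_l (if col l == 0 then E * p.-1 else 0))%N.
  by rewrite -big_mkcond sum_nat_const mulnC.
apply: val_ge_prod => l _; rewrite sum_Teichmuller.
case: eqP => _; first exact: val_ge_card.
case: ifP => _; last exact: val_ge0.
exact/val_ge_reduces/reduces_to_nat.
Qed.

End Monomials.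

End Characters.

(** * Counting solutions *)

Lemma ceil_div_leq a b c : (0 < b)%N -> (ceil_div a b <= c)%N = (a <= b * c)%N.
Proof.
by move=> b0; rewrite /ceil_div -ltnS ltn_divLR //; apply/idP/idP; nia.
Qed.

Section Counting.
Variables (K : finFieldType) (k q : nat).

Lemma NsolE (f : {mpoly K[k]}) :
  Nsol q f =
    (\sum_(x : {ffun 'I_k -> K}) #|[pred y : K | (y ^+ q - y == f.@[x])%R]|)%N.
Proof.
rewrite /Nsol cardsE -sum1_card.
under [RHS]eq_bigr do rewrite -sum1_card.
rewrite pair_big_dep /=; apply: eq_bigl => -[x y].
by rewrite !inE /= eq_sym.
Qed.

Lemma meval_monomials (f : {mpoly K[k]}) (x : {ffun 'I_k -> K}) :
  f.@[x] = \sum_(i < size (msupp f)) f@_(tnth (in_tuple (msupp f)) i) *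
             \prod_l x l ^+ (tnth (in_tuple (msupp f)) i l).
Proof. by rewrite mevalE big_tnth. Qed.

(** The origin with [y = 0] is a solution. Positivity matters because [logn p 0] is 0. *)
Lemma Nsol_gt0 (f : {mpoly K[k]}) d :
  (0 < d)%N -> (0 < q)%N -> f \is d.-homog -> (0 < Nsol q f)%N.
Proof.
move=> d0 q0 /dhomogP fd; rewrite card_gt0; apply/set0Pn.
exists ([ffun=> 0], 0); rewrite inE /= expr0n (gtn_eqF q0) subr0 mevalE.
rewrite big_seq big1 // => mm /fd md; have {}md : (\sum_l mm l = d)%N by rewrite -mdegE.
have [l ml] : exists l, mm l != 0%N.
  apply/existsP; apply: contraT; rewrite negb_exists => /forallP m0.
  by move: d0; rewrite -md big1 // => l _; apply/eqP; have := m0 l; rewrite negbK.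
by rewrite (bigD1 l) //= ffunE expr0n (negPf ml) mul0r mulr0.
Qed.

End Counting.

Section MainTheorem.
Variables (K : finFieldType) (p e m k d : nat).
Hypothesis p_prime : prime p.
Hypothesis e_gt0 : (0 < e)%N.
Hypothesis m_gt0 : (0 < m)%N.
Hypothesis k_gt0 : (0 < k)%N.
Hypothesis d_gt0 : (0 < d)%N.
Let E := (e * m)%N.
Hypothesis cardK : #|K| = (p ^ E)%N.
Let q := (p ^ e)%N.
Let n := (p ^ E).-1.
Let g := gcdn d (n %/ q.-1).
Let p_gt0 := prime_gt0 p_prime.
Let E_gt0 : (0 < E)%N. Proof. by rewrite muln_gt0 e_gt0. Qed.

Lemma logn_Nsol_ge (f : {mpoly K[k]}) : f \is d.-homog ->
  (ceil_div (E * ceil_div (g * k) d) g <= logn p (Nsol q f))%N.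
Proof.
move=> fd; set C := ceil_div _ d.
have g0 : (0 < g)%N by rewrite gcdn_gt0 d_gt0.
have N0 : (0 < Nsol q f)%N by apply: Nsol_gt0 fd; rewrite // expn_gt0 p_gt0.
have [w w_prim0] := finField_prim_root K.
have w_prim : n.-primitive_root w by rewrite /n -cardK.
have pn0 : (0 < p * n)%N by rewrite muln_gt0 p_gt0 (prim_order_gt0 w_prim).
have [z z_prim] := C_prim_root_exists pn0.
pose a (i : 'I_(size (msupp f))) := f@_(tnth (in_tuple (msupp f)) i).
pose D i (l : 'I_k) := (tnth (in_tuple (msupp f)) i) l.
have sumD i : (\sum_l D i l = d)%N.
  by rewrite /D -mdegE; apply: (dhomogP _ _ _ fd); apply: mem_tnth.
(* Valuations are counted in powers of the uniformizer, where [p] weighs [p.-1]; this factor is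
   cancelled at the end. *)
pose v0 := ceil_div (E * p.-1 * C) g.
have leC A : (g * k <= d * A -> C <= A)%N by rewrite ceil_div_leq.
have lev0 s : (E * p.-1 * C <= g * s -> v0 <= s)%N by rewrite ceil_div_leq.
have := val_ge_sum_psi p_prime E_gt0 cardK w_prim z_prim a e_gt0 (erefl _) d_gt0
  sumD leC lev0.
have -> : \sum_(x : {ffun 'I_k -> K}) \sum_(t | t ^+ (p ^ e) == t)
      psi p E z (t * \sum_i a i * \prod_l x l ^+ D i l) = (Nsol q f)%:R.
  rewrite NsolE natr_sum; apply: eq_bigr => x _.
  rewrite (card_Artin_Schreier p_prime E_gt0 cardK w_prim z_prim).
  by rewrite meval_monomials.
move/(val_ge_nat (pcharK p_prime cardK) w_prim z_prim N0).
rewrite /v0 !ceil_div_leq // => le.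
have p1 : (0 < p.-1)%N by have := prime_gt1 p_prime; lia.
by rewrite -(leq_pmul2l p1); lia.
Qed.

(** * Sharpness: averaging over combinations of block monomials *)

Let B := ceil_div k d.

Let block_lt (b : 'I_B) : (b * d < k)%N.
Proof.
by have := ltn_ord b; rewrite ltnNge ceil_div_leq // -ltnNge mulnC.
Qed.

Let index_lt (b : 'I_B) (j : 'I_d) : (minn (b * d + j) k.-1 < k)%N.
Proof. by rewrite gtn_min ltn_predL k_gt0 orbT. Qed.

(* The variables are cut into B blocks of at most d consecutive ones; the last
   variable is repeated in the last block to reach degree d. *)
Let block_monomial (b : 'I_B) : {mpoly K[k]} :=
  \prod_(j < d) 'X_(Ordinal (index_lt b j)).

Let family (a : {ffun 'I_B -> K}) : {mpoly K[k]} :=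
  \sum_b a b *: block_monomial b.

(** Squarefree counterpart of [block_monomial], with the same zeros; each variable lies in exactly
    one block, so that sums over points factor. *)
Let block_prod (b : 'I_B) (x : {ffun 'I_k -> K}) := \prod_(l < k | (l %/ d == b)%N) x l.

Lemma family_homog a : family a \is d.-homog.
Proof.
apply: rpred_sum => b _; apply: rpredZ; rewrite /block_monomial.
suff H r : (\prod_(j <- r) 'X_(Ordinal (index_lt b j)) : {mpoly K[k]}) \is (size r).-homog.
  by have := H (enum 'I_d); rewrite size_enum_ord big_enum.
elim: r => [|j r IH]; first by rewrite big_nil dhomog1.
by rewrite big_cons -[size _]add1n; apply: dhomogM => //; rewrite dhomogX /= mdeg1.
Qed.

Lemma meval_family a (x : {ffun 'I_k -> K}) :
  (family a).@[x] = \sum_b a b * (block_monomial b).@[x].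
Proof. by rewrite /family rmorph_sum; apply: eq_bigr => b _; rewrite /= mevalZ. Qed.

Lemma meval_block_monomial b (x : {ffun 'I_k -> K}) :
  ((block_monomial b).@[x] == 0) = (block_prod b x == 0).
Proof.
rewrite /block_monomial rmorph_prod /=; apply/eqP/eqP => /eqP.
  case/prodf_eq0 => j _; rewrite /= mevalXU => /eqP xj.
  rewrite /block_prod (bigD1 (Ordinal (index_lt b j))) /= ?xj ?mul0r //.
  have := block_lt b; have := ltn_ord j => jd bk.
  rewrite eqn_leq -ltnS ltn_divLR // leq_divRL //.
  by apply/andP; split; lia.
case/prodf_eq0 => l /eqP lb /eqP xl.
have ld : (l %% d < d)%N by rewrite ltn_mod.
rewrite (bigD1 (Ordinal ld)) //= mevalXU.
suff -> : Ordinal (index_lt b (Ordinal ld)) = l by rewrite xl mul0r.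
apply: val_inj; rewrite /= -lb -divn_eq; have := ltn_ord l; lia.
Qed.

Let Z := #|[pred x : {ffun 'I_k -> K} | [forall b, block_prod b x == 0]]|.

Lemma expf_card_pred (u : K) : u ^+ n = (u != 0)%:R.
Proof.
have n1 : #|K| = n.+1 by rewrite cardK prednK // expn_gt0 p_gt0.
case: eqP => [->|/eqP u0].
  by rewrite expr0n; have := finNzRing_gt1 K; rewrite n1; case: (n).
by apply: (mulfI u0); rewrite -exprS -n1 expf_card mulr1.
Qed.

(** The indicator of a zero of [block_prod b] is [1 - block_prod b x ^+ n]. Expand the product over
    [b] along the sets [S] of chosen blocks: a variable outside them contributes the sum of 1 over
    [K], which is 0. Blocks being nonempty, only the full [S] remains, where each variable
    contributes -1. *)
Lemma natr_Z : Z%:R = (-1) ^+ B * (-1) ^+ k :> K.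
Proof.
have pK := pcharK p_prime cardK.
have sum1 : \sum_(u : K) 1 = 0 :> K.
  by rewrite sumr_const cardK natrX (pcharf0 pK) expr0n (gtn_eqF E_gt0).
have sumn : \sum_(u : K) u ^+ n = -1.
  under eq_bigr do rewrite expf_card_pred.
  apply: (@addIr _ 1); rewrite addNr -[RHS]sum1 [RHS](bigD1 0) //= [RHS]addrC.
  congr (_ + 1); rewrite (bigD1 0) //= eqxx add0r.
  by apply: eq_bigr => u ->.
transitivity (\sum_(x : {ffun 'I_k -> K}) \prod_b (1 - block_prod b x ^+ n)).
  rewrite /Z -sum1_card natr_sum big_mkcond; apply: eq_bigr => x _ /=.
  have -> : \prod_b (1 - block_prod b x ^+ n) = \prod_b (block_prod b x == 0)%:R.
    by apply: eq_bigr => b _; rewrite expf_card_pred; case: eqP; rewrite ?subr0 ?subrr.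
  rewrite inE; case: ifPn => [/forallP H|]; first by rewrite big1 // => b _; rewrite H.
  by rewrite negb_forall => /existsP [b /negPf Hb]; rewrite (bigD1 b) //= Hb mul0r.
under eq_bigr => x _ do under eq_bigr do rewrite addrC.
under eq_bigr => x _ do rewrite bigA_distr.
rewrite exchange_big /=.
have blk_lt (l : 'I_k) : (l %/ d < B)%N.
  rewrite ltnNge ceil_div_leq // -ltnNge mulnC.
  exact: leq_ltn_trans (leq_trunc_div l d) (ltn_ord l).
pose blk l := Ordinal (blk_lt l).
have sumS S : \sum_(x : {ffun 'I_k -> K})
    \prod_b (if b \in S then - block_prod b x ^+ n else 1) =
    (\prod_b (if b \in S then -1 else 1)) * \prod_l (if blk l \in S then -1 else 0).
  transitivity ((\prod_b (if b \in S then -1 else 1)) *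
      \prod_l \sum_(u : K) (if blk l \in S then u ^+ n else 1)); last first.
    by congr (_ * _); apply: eq_bigr => l _; case: ifP.
  rewrite bigA_distr_bigA /= [RHS]mulr_sumr; apply: eq_bigr => x _.
  rewrite (partition_big blk predT) //= -big_split; apply: eq_bigr => b _ /=.
  have -> : \prod_(l | blk l == b) (if blk l \in S then x l ^+ n else 1) =
            (if b \in S then block_prod b x ^+ n else 1).
    rewrite (eq_bigr (fun l => if b \in S then x l ^+ n else 1)); last first.
      by move=> l /eqP ->.
    by case: ifP => _; [rewrite /block_prod prodrXl | rewrite big1].
  by case: ifP; rewrite ?mulN1r ?mulr1.
under eq_bigr do rewrite sumS.
rewrite (bigD1 [set: 'I_B]) //= [X in _ + X]big1 ?addr0 => [|S ST].
  by congr (_ * _); under eq_bigr do rewrite inE; rewrite prodr_const card_ord.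
have [b bS] : exists b, b \notin S.
  apply/existsP; apply: contraR ST; rewrite negb_exists => /forallP H.
  by apply/eqP/setP => b; rewrite inE; have := H b; rewrite negbK.
rewrite [X in _ * X](bigD1 (Ordinal (block_lt b))) //=.
have -> : blk (Ordinal (block_lt b)) = b by apply: val_inj; rewrite /= mulnK.
by rewrite (negPf bS) mul0r mulr0.
Qed.

Let fixed_card := #|[pred t : K | t ^+ q == t]|.

(** Where all block monomials vanish, every member of the family takes the value 0. Elsewhere the
    value is equidistributed over [K] as [a] varies, and the average number of [y] is 1. *)
Lemma sum_card_family (x : {ffun 'I_k -> K}) :
  (\sum_(a : {ffun 'I_B -> K}) #|[pred y : K | (y ^+ q - y == (family a).@[x])%R]| =
   (p ^ E) ^ B * (if [forall b, block_prod b x == 0%R] then fixed_card else 1))%N.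
Proof.
pose N c := #|[pred y : K | y ^+ q - y == c]|.
pose L (a : {ffun 'I_B -> K}) := \sum_b a b * (block_monomial b).@[x].
have cardA : #|{ffun 'I_B -> K}| = ((p ^ E) ^ B)%N by rewrite card_ffun card_ord cardK.
rewrite (eq_bigr (fun a => N (L a))) => [|a _]; last by rewrite meval_family.
case: ifPn => [/forallP H|].
  rewrite (eq_bigr (fun=> fixed_card)) ?sum_nat_const ?cardA // => a _.
  rewrite /L big1 => [|b _]; last first.
    by have := H b; rewrite -meval_block_monomial => /eqP ->; rewrite mulr0.
  by apply: eq_card => y; rewrite !inE subr_eq0.
rewrite negb_forall => /existsP [b0]; rewrite -meval_block_monomial => nz.
(* Moving [a b0] by [h] over the nonzero value of [block_monomial b0] translates [L a] by [h]; the
   sum can thus be averaged over [h]. *)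
have shift h : (\sum_a N (L a) = \sum_a N (L a + h)%R)%N.
  pose dl : {ffun 'I_B -> K} := [ffun b => if b == b0 then h / (block_monomial b0).@[x] else 0].
  rewrite (reindex (fun a : {ffun 'I_B -> K} => a + dl)) /=; last first.
    by apply: onW_bij; exists (fun a : {ffun 'I_B -> K} => a - dl) => a; rewrite ?addrK ?subrK.
  apply: eq_bigr => a _; congr (N _).
  rewrite /L; under eq_bigr do rewrite ffunE mulrDl.
  rewrite big_split /=; congr (_ + _).
  rewrite (bigD1 b0) //= ffunE eqxx divfK // big1 ?addr0 // => b /negPf bb0.
  by rewrite ffunE bb0 mul0r.
have Q0 : (0 < p ^ E)%N by rewrite expn_gt0 p_gt0.
apply/eqP; rewrite muln1 -(eqn_pmul2l Q0) -{1}cardK -sum_nat_const.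
apply/eqP; rewrite (eq_bigr (fun h => \sum_a N (L a + h)%R))%N => [|h _]; last exact: shift.
rewrite exchange_big /= (eq_bigr (fun=> p ^ E)%N) => [|a _].
  by rewrite sum_nat_const cardA mulnC.
rewrite -(sum_card_preim cardK (fun y => y ^+ q - y)) (reindex (fun h => h - L a)) /=.
  by apply: eq_bigr => h _; rewrite addrC subrK.
by apply: onW_bij; exists (fun h => h + L a) => h; rewrite ?addrK ?subrK.
Qed.

(** If [p ^ (E * B).+1] divided every count, [p] would divide [T], the sum of all counts over
    [p ^ (E * B)]. But [T = (p ^ E) ^ k - Z + Z * fixed_card] is [- Z] modulo [p], and [Z] is prime
    to [p] by [natr_Z]. *)
Lemma exists_logn_Nsol_le : exists f : {mpoly K[k]},
  [/\ f != 0, f \is d.-homog & (logn p (Nsol q f) <= E * B)%N].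
Proof.
have pK := pcharK p_prime cardK.
have B_le_k : (B <= k)%N by rewrite ceil_div_leq // leq_pmull.
have p_fixed : (p %| fixed_card)%N := dvdn_card_fixed p_prime cardK e.
have p_Q : (p %| p ^ E)%N by rewrite dvdn_exp.
have [/forallP all_dvd|] := boolP [forall a, p ^ (E * B).+1 %| Nsol q (family a)]%N.
  have : (p ^ (E * B).+1 %| \sum_a Nsol q (family a))%N by apply: dvdn_sum.
  under eq_bigr do rewrite NsolE.
  rewrite exchange_big /=; under eq_bigr do rewrite sum_card_family.
  rewrite -big_distrr /= expnSr expnM dvdn_pmul2l ?expn_gt0 ?p_gt0 //.
  set T := (\sum_(x : {ffun _}) _)%N => pT.
  have TZ : (T + Z = (p ^ E) ^ k + Z * fixed_card)%N.
    have -> : Z = (\sum_(x : {ffun 'I_k -> K}) [forall b, block_prod b x == 0%R])%N.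
      by rewrite /Z -sum1_card big_mkcond; apply: eq_bigr => x _; rewrite inE; case: ifP.
    have -> : ((p ^ E) ^ k = \sum_(x : {ffun 'I_k -> K}) 1)%N.
      by rewrite sum1_card card_ffun card_ord cardK.
    rewrite big_distrl -!big_split /=; apply: eq_bigr => x _.
    by case: ifP => _; rewrite ?mul1n // addnC.
  have : (p %| Z)%N.
    by rewrite -(dvdn_addr _ pT) TZ dvdn_add ?dvdn_mull ?dvdn_exp.
  by rewrite (dvdn_pcharf pK) natr_Z -signr_odd mulf_eq0 !signr_eq0.
rewrite negb_forall => /existsP [a na]; exists (family a).
have fa := family_homog a.
have N0 : (0 < Nsol q (family a))%N by apply: Nsol_gt0 fa; rewrite // expn_gt0 p_gt0.
split => //; last by rewrite pfactor_dvdn // -leqNgt in na.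
(* The zero polynomial has [(p ^ E) ^ k * fixed_card] solutions, divisible by [p ^ (E * B).+1] since
   [B <= k], so the chosen member is nonzero. *)
apply: contra na => /eqP ->; rewrite NsolE.
rewrite (eq_bigr (fun=> fixed_card)) => [|x _]; last first.
  by apply: eq_card => y; rewrite !inE meval0 subr_eq0.
rewrite sum_nat_const card_ffun card_ord cardK expnSr dvdn_mul //.
by rewrite -expnM dvdn_exp2l // leq_mul2l B_le_k orbT.
Qed.

End MainTheorem.

Theorem theorem5p3 (p e m k d : nat) (K : finFieldType) :
  prime p -> (0 < e)%N -> (0 < m)%N -> (0 < k)%N -> (0 < d)%N ->
  #|K| = ((p ^ e) ^ m)%N ->
  let q := (p ^ e)%N in
  let g := gcdn d (((q ^ m).-1) %/ q.-1) in
  (forall f : {mpoly K[k]}, (f != 0)%R -> f \is d.-homog ->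
     (ceil_div (e * m * ceil_div (g * k) d) g <= logn p (Nsol q f))%N) /\
  (g = 1%N ->
     (forall f : {mpoly K[k]}, (f != 0)%R -> f \is d.-homog ->
        (e * m * ceil_div k d <= logn p (Nsol q f))%N) /\
     (exists f : {mpoly K[k]}, [/\ (f != 0)%R, f \is d.-homog &
        logn p (Nsol q f) = (e * m * ceil_div k d)%N])).
Proof.
move=> p_prime e0 m0 k0 d0 cardK q g.
rewrite -expnM in cardK.
have lower (f : {mpoly K[k]}) : f \is d.-homog ->
    (ceil_div (e * m * ceil_div (g * k) d) g <= logn p (Nsol q f))%N.
  by rewrite /g /q -expnM; apply: logn_Nsol_ge.
split=> [f _|g1]; first exact: lower.
have lower1 (f : {mpoly K[k]}) : f \is d.-homog -> (e * m * ceil_div k d <= logn p (Nsol q f))%N.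
  by move/lower; rewrite g1 mul1n /ceil_div addn0 divn1.
split=> [f _|]; first exact: lower1.
have [f [f0 fd le_f]] := exists_logn_Nsol_le p_prime e0 m0 k0 d0 cardK.
by exists f; split=> //; apply/eqP; rewrite eqn_leq le_f lower1.
Qed.
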